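(* Let $q\ge 5$ be an integer. For every integer $n\ge 2$, replacing each letter $1$ by $A$ and each letter $0$ by $B$ in the binary word $01f_{2n-3}^{[q]}$ (the concatenation of the word $01$ with $f_{2n-3}^{[q]}$) yields exactly the $q$-hyperbolic Pascal word $h_n^{[q]}$; that is, $01f_{2n-3}^{[q]}\equiv h_n^{[q]}$. Moreover, for every $n\ge 2$, $$|f_{2n-3}^{[q]}|=F_{2n-2}^{(1,q-4)}.$$ Here $|h_n^{[q]}|=s_n$ is the number of vertices in row $n$ of the hyperbolic Pascal triangle.
   Context: Words and lengths: juxtaposition of words is concatenation, $w^m$ is the $m$-fold concatenation of $w$ with itself, and $|w|$ is the length of $w$. $\{4,q\}$-Fibonacci words: for an integer $q\ge5$, the finite binary words $f_i^{[q]}$ over $\{0,1\}$ are defined by $f_0^{[q]}=1$, $f_1^{[q]}=0$, and for $i\ge2$: $f_i^{[q]}=\left(f_{i-1}^{[q]}\right)^{q-4}f_{i-2}^{[q]}$ if $i$ is even, and $f_i^{[q]}=f_{i-1}^{[q]}f_{i-2}^{[q]}$ if $i$ is odd. Biperiodic Fibonacci sequence: for positive integers $a,b$, $F_0^{(a,b)}=0$, $F_1^{(a,b)}=1$, and for $i\ge2$: $F_i^{(a,b)}=aF_{i-1}^{(a,b)}+F_{i-2}^{(a,b)}$ if $i$ is even, $F_i^{(a,b)}=bF_{i-1}^{(a,b)}+F_{i-2}^{(a,b)}$ if $i$ is odd. Hyperbolic Pascal triangle for the mosaic $\{4,q\}$, $q\ge5$ (row structure): it is a directed graph whose vertices are arranged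 in rows $0,1,2,\dots$, each row being ordered from left to right. Row $0$ consists of a single base vertex, and row $1$ consists of two vertices, its two descendants. In each row $n\ge1$ the leftmost and rightmost vertices are called wingers; every other vertex is of type $A$ or type $B$. Row $j+1$ ($j\ge1$) is obtained from row $j$ as follows: going from left to right along row $j$, one draws downwards $2$ edges from each winger, $q-2$ edges from each type $A$ vertex, and $q-1$ edges from each (non-winger) type $B$ vertex, the edges at each vertex being ordered from left to right. For any two neighbouring vertices of row $j$, the last edge of the left one and the first edge of the right one end in a common vertex of row $j+1$, which is of type $A$. All other edges end in distinct vertices of row $j+1$, each having only one ascendant; among these, the leftmost and the rightmost ones are the wingers of row $j+1$, and the others are of type $B$. The vertices of row $j+1$ are ordered from left to right according to the edges. $q$-hyperbolic Pascal words: by convention the base vertex and all wingers are also labelled $B$. The word $h_n^{[q]}$ over $\{A,B\}$ is the concatenation, from left to right, of the labels of the vertices in row $n$; its length is $s_n$, the total number of vertices in row $n$. For instance $h_0^{[q]}=B$, $h_1^{[q]}=BB$, $h_2^{[q]}=BAB$, and for $q=5$, $h_3^{[5]}=BABAB$, $h_4^{[5]}=BABABBABAB$. Equivalence: let $\phi$ be the letter-to-letter map $\phi(1)=A$, $\phi(0)=B$, extended to words. For a word $u$ over $\{0,1\}$ and a word $v$ over $\{A,B\}$, $u\equiv v$ means $\phi(u)=v$. *)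

(* Defs.v *)
From mathcomp Require Import all_boot.

Set Implicit Arguments.
Unset Strict Implicit.
Unset Printing Implicit Defensive.

Definition wpow (T : Type) (w : seq T) (m : nat) : seq T := flatten (nseq m w).

(* Binary letters are booleans: [true] is the letter 1, [false] the letter 0. *)
Fixpoint fibword (q i : nat) : seq bool :=
  match i with
  | 0 => [:: true]
  | i1.+1 =>
    match i1 with
    | 0 => [:: false]
    | i2.+1 =>
      if odd i then fibword q i1 ++ fibword q i2
      else wpow (fibword q i1) (q - 4) ++ fibword q i2
    end
  end.

Fixpoint bifib (a b i : nat) : nat :=
  match i with
  | 0 => 0
  | i1.+1 =>
    match i1 with
    | 0 => 1
    | i2.+1 => (if odd i then b else a) * bifib a b i1 + bifib a b i2
    end
  end.

Inductive kind := Base | Winger | TypeA | TypeB.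

(* The edge [(i, k)] leaving a row is the [k]-th one (from the left, counting
   from 0) drawn downwards from the [i]-th vertex of that row. *)
Definition edge := (nat * nat)%type.

(* A vertex carries the edges from the previous row that end in it, so that a
   row determines the part of the directed graph lying just above it. *)
Record vertex := Vertex { vkind : kind; in_edges : seq edge }.

Definition outdeg (q : nat) (c : kind) : nat :=
  match c with
  | Base => 2
  | Winger => 2
  | TypeA => q - 2
  | TypeB => q - 1
  end.

Section NextRow.

Variables (q : nat) (row : seq vertex).

Definition deg_at (i : nat) : nat :=
  nth 0 [seq outdeg q (vkind v) | v <- row] i.

Definition out_edges : seq edge :=
  [seq (i, k) | i <- iota 0 (size row), k <- iota 0 (deg_at i)].

(* [e] is the last edge of a vertex and [e'] is the first edge of its right
   neighbour: these end in a common vertex of the next row. *)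
Definition meet (e e' : edge) : bool :=
  [&& e'.1 == e.1.+1, e.2.+1 == deg_at e.1 & e'.2 == 0].

(* Groups the edges by their common end; meeting edges are consecutive in the
   left-to-right list [out_edges]. *)
Fixpoint bundle (es : seq edge) : seq (seq edge) :=
  match es with
  | [::] => [::]
  | e :: es' =>
    match bundle es' with
    | (e' :: b) :: bs =>
      if meet e e' then (e :: e' :: b) :: bs
      else [:: e] :: (e' :: b) :: bs
    | bs => [:: e] :: bs
    end
  end.

Definition ends : seq (seq edge) := bundle out_edges.

Definition single (b : seq edge) : bool := size b == 1.

(* The wingers are the leftmost and the rightmost ends having only one
   incoming edge. *)
Definition end_kind (j : nat) : kind :=
  if ~~ single (nth [::] ends j) then TypeA
  else if ~~ has single (take j ends) || ~~ has single (drop j.+1 ends)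
  then Winger
  else TypeB.

Definition next_row : seq vertex :=
  [seq Vertex (end_kind j) (nth [::] ends j) | j <- iota 0 (size ends)].

End NextRow.

Fixpoint pascal_row (q n : nat) : seq vertex :=
  match n with
  | 0 => [:: Vertex Base [::]]
  | n1.+1 =>
    match n1 with
    | 0 => [:: Vertex Winger [:: (0, 0)]; Vertex Winger [:: (0, 1)]]
    | _.+1 => next_row q (pascal_row q n1)
    end
  end.

Definition row_size (q n : nat) : nat := size (pascal_row q n).

Inductive letter := A | B.

Definition label (v : vertex) : letter :=
  if vkind v is TypeA then A else B.

Definition pascal_word (q n : nat) : seq letter :=
  [seq label v | v <- pascal_row q n].

Definition phi (x : bool) : letter := if x then A else B.

Definition word_equiv (u : seq bool) (v : seq letter) : Prop :=
  [seq phi x | x <- u] = v.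

(* Main.v *)
(** Write row [n >= 2] as [0 1 g 0].  Reading the edges from left to right, each
    inner vertex produces its unshared edges followed by the vertex it shares
    with its right neighbour, so the next row is [0 1 tau(1 g) 0], where
    [tau(1) = 0^(q-4) 1] and [tau(0) = 0^(q-3) 1].  On the other side
    [f_(i+2) = rho(f_i)] for [rho(1) = f_2 = 0^(q-4) 1] and
    [rho(0) = f_3 = 0^(q-4) 1 0].  The two substitutions are conjugate:
    [0^(q-4) 1 tau(g) = rho(g) 0^(q-4) 1]; hence [f_(2n-3) = g 0] gives
    [f_(2n-1) = rho(g) 0^(q-4) 1 0 = tau(1 g) 0]. *)

Require Import Defs.
From mathcomp Require Import all_boot.

Set Implicit Arguments.
Unset Strict Implicit.
Unset Printing Implicit Defensive.

Definition subst (S T : Type) (s : S -> seq T) (w : seq S) : seq T :=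
  flatten (map s w).

Lemma subst_cat (S T : Type) (s : S -> seq T) (u v : seq S) :
  subst s (u ++ v) = subst s u ++ subst s v.
Proof. by rewrite /subst map_cat flatten_cat. Qed.

Lemma subst_wpow (S T : Type) (s : S -> seq T) (w : seq S) (m : nat) :
  subst s (wpow w m) = wpow (subst s w) m.
Proof.
elim: m => [|m IH] //.
by rewrite /wpow /= -/(wpow w m) subst_cat IH.
Qed.

(** With the parity moved into the exponent, one recurrence covers both cases. *)
Lemma fibwordSS (q i : nat) :
  fibword q i.+2 =
  wpow (fibword q i.+1) (if odd i then 1 else q - 4) ++ fibword q i.
Proof.
rewrite /= negbK; case: (odd i) => //.
by rewrite /wpow /= cats0.
Qed.

Lemma bifibSS (a b i : nat) :
  bifib a b i.+2 = (if odd i then b else a) * bifib a b i.+1 + bifib a b i.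
Proof. by rewrite /= negbK. Qed.

Lemma size_wpow (T : Type) (w : seq T) (m : nat) :
  size (wpow w m) = m * size w.
Proof. by elim: m => //= m IH; rewrite /wpow /= size_cat -/(wpow w m) IH. Qed.

(** The index shift swaps parities: the power [q - 4], taken at even word indices, becomes the
    coefficient at odd indices. *)
Lemma size_fibword (q i : nat) : size (fibword q i) = bifib 1 (q - 4) i.+1.
Proof.
suff []: size (fibword q i) = bifib 1 (q - 4) i.+1 /\
         size (fibword q i.+1) = bifib 1 (q - 4) i.+2 by [].
elim: i => [|i [IH1 IH2]] //; split=> //.
rewrite fibwordSS size_cat size_wpow IH1 IH2 bifibSS /=.
by case: (odd i).
Qed.

Definition rho (m : nat) (x : bool) : seq bool :=
  nseq m false ++ true :: (if x then [::] else [:: false]).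

Definition tau (m : nat) (x : bool) : seq bool :=
  nseq (~~ x + m) false ++ [:: true].

Lemma wpow_letter (T : Type) (x : T) (m : nat) : wpow [:: x] m = nseq m x.
Proof. by elim: m => //= m <-. Qed.

(** Indices [i] and [i + 2] have the same parity, hence the same recurrence, which a substitution
    preserves; [rho] is chosen to fit the first two words. *)
Lemma fibword_rho (q i : nat) :
  fibword q i.+2 = subst (rho (q - 4)) (fibword q i).
Proof.
suff []: fibword q i.+2 = subst (rho (q - 4)) (fibword q i) /\
         fibword q i.+3 = subst (rho (q - 4)) (fibword q i.+1) by [].
elim: i => [|i [IH1 IH2]].
  by rewrite /subst /= wpow_letter /rho !cats0 -catA.
split; first exact: IH2.
rewrite [in RHS]fibwordSS subst_cat subst_wpow -IH1 -IH2 fibwordSS.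
by have -> : odd i.+2 = odd i by exact: negbK.
Qed.

(** Letter by letter, [0^m 1 tau(x) = rho(x) 0^m 1], so the factor [0^m 1] moves across [g]. *)
Lemma tau_rho (m : nat) (g : seq bool) :
  (nseq m false ++ [:: true]) ++ subst (tau m) g =
  subst (rho m) g ++ nseq m false ++ [:: true].
Proof.
elim: g => [|x g IH]; first by rewrite cats0.
rewrite /subst /= -!/(subst _ _) -[RHS]catA -IH.
by case: x; rewrite /tau /rho /= -?catA.
Qed.

(* [true] marks the ends with a single incoming edge; the first end, which
   belongs to the leftmost vertex, is left out. *)
Fixpoint end_flags (ds : seq nat) : seq bool :=
  match ds with
  | [::] => [::]
  | [:: d] => nseq d.-1 true
  | d :: ds' => nseq d.-2 true ++ false :: end_flags ds'
  end.

Section Bundle.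

Variables (q : nat) (row : seq vertex).

Definition vertex_edges (i k l : nat) : seq edge := [seq (i, j) | j <- iota k l].

Lemma bundle_cons_same (i k k' : nat) (es b : seq edge) (bs : seq (seq edge)) :
  bundle q row es = ((i, k') :: b) :: bs ->
  bundle q row ((i, k) :: es) = [:: (i, k)] :: ((i, k') :: b) :: bs.
Proof. by move=> /= ->; rewrite /meet /= eqn_leq ltnn andbF. Qed.

Lemma bundle_last_vertex (i k l : nat) :
  bundle q row (vertex_edges i k l.+1) =
  [:: (i, k)] :: [seq [:: e] | e <- vertex_edges i k.+1 l].
Proof. by elim: l k => // l IH k; apply/bundle_cons_same/IH. Qed.

Lemma bundle_vertex (i k l : nat) (es : seq edge) (bs : seq (seq edge)) :
  deg_at q row i = k + l.+1 -> bundle q row es = [:: (i.+1, 0)] :: bs ->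
  bundle q row (vertex_edges i k l.+1 ++ es) =
  [seq [:: e] | e <- vertex_edges i k l] ++ [:: (i, k + l); (i.+1, 0)] :: bs.
Proof.
move=> + bsE; elim: l k => [|l IH] k degE.
  by rewrite /= bsE /meet /= degE addn0 addn1 !eqxx.
rewrite -addSnnS in degE; rewrite -addSnnS.
(* The next bundle is the shared one if [l = 0] and a single edge otherwise; either way it starts
   with an edge of [i]. *)
by case: l IH degE => [|l] IH degE; apply: bundle_cons_same (IH _ degE).
Qed.

(** [bundle] works from the right, hence the induction on suffixes of the row. Degrees being at
    least 2, the first edge of a vertex is not its last, so it stays alone until the left neighbour
    is added. *)
Lemma bundle_suffix (i : nat) (ds : seq nat) :
    0 < size ds -> all (leq 2) ds ->
    (forall j, j < size ds -> deg_at q row (i + j) = nth 0 ds j) ->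
  exists2 bs,
    bundle q row [seq (j, k) | j <- iota i (size ds), k <- iota 0 (deg_at q row j)]
      = [:: (i, 0)] :: bs
    & map single bs = end_flags ds.
Proof.
elim: ds i => [//|d ds IH] i _ /= /andP[d_ge2 ds_ge2] degE.
have di : deg_at q row i = d by have := degE 0 isT; rewrite addn0.
have d'E : d = d.-2.+2 by case: d d_ge2 {degE di} => [|[]].
have single_edges es : map single [seq [:: e] | e : edge <- es] = nseq (size es) true.
  by elim: es => //= e es ->.
case: ds IH ds_ge2 degE => [|d2 ds] IH ds_ge2 degE.
  rewrite /= cats0 di d'E; eexists; first exact: (bundle_last_vertex i 0 d.-2.+1).
  by rewrite single_edges size_map size_iota.
have [//|j lt_j|bs bsE bs_flags] := IH i.+1 isT.
  by rewrite addSnnS (degE j.+1).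
rewrite di d'E; eexists.
  by apply: (@bundle_vertex i 0 d.-2.+1 _ bs); [rewrite di d'E | exact: bsE].
by rewrite map_cat single_edges size_map size_iota /= bs_flags.
Qed.

End Bundle.

Definition inner_kind (x : bool) : kind := if x then TypeA else TypeB.

Definition row_kinds (w : seq bool) : seq kind :=
  Winger :: rcons (map inner_kind w) Winger.

(** The extreme ends are single, hence wingers; any other end has a single one on each side, so its
    own flag decides its type. *)
Lemma kinds_next_row_flags (q : nat) (row : seq vertex) (fs : seq bool) :
  map single (ends q row) = true :: rcons fs true ->
  map vkind (next_row q row) = row_kinds (map negb fs).
Proof.
move=> flagsE; rewrite /next_row -map_comp.
have szE : size (ends q row) = (size fs).+2.
  by rewrite -(size_map single) flagsE /= size_rcons.
apply: (@eq_from_nth _ Winger) => [|j].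
  by rewrite size_map size_iota szE /= size_rcons !size_map.
rewrite size_map size_iota => lt_j.
rewrite (nth_map 0) ?size_iota // nth_iota // add0n /= /end_kind.
have -> : single (nth [::] (ends q row) j) = nth false (true :: rcons fs true) j.
  by rewrite -flagsE (nth_map [::]).
have -> : has single (take j (ends q row)) = has id (take j (true :: rcons fs true)).
  by rewrite -flagsE -map_take has_map.
have -> : has single (drop j.+1 (ends q row)) =
          has id (drop j.+1 (true :: rcons fs true)).
  by rewrite -flagsE -map_drop has_map.
case: j lt_j => [|j] //=; rewrite szE !ltnS => le_j.
rewrite !nth_rcons !size_map.
case: ltngtP le_j => // [lt_j _|-> _]; last first.
  by rewrite drop_oversize ?size_rcons.
by rewrite drop_rcons // has_rcons /= !(nth_map false) ?size_map //.
Qed.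

Lemma end_flags_cons (d : nat) (ds : seq nat) :
  0 < size ds -> end_flags (d :: ds) = nseq d.-2 true ++ false :: end_flags ds.
Proof. by case: ds. Qed.

(** The left winger yields the new left winger and the shared end [true]; the right one shares its
    first edge and adds only the new right winger. *)
Lemma kinds_next_row (q : nat) (row : seq vertex) (w : seq bool) :
  5 <= q -> map vkind row = row_kinds w ->
  map vkind (next_row q row) = row_kinds (true :: subst (tau (q - 4)) w).
Proof.
move=> q_ge5 rowE.
pose ds := map (outdeg q) (row_kinds w).
have deg_row : map (fun v => outdeg q (vkind v)) row = ds.
  by rewrite (map_comp (outdeg q)) rowE.
have szE : size ds = size row by rewrite -deg_row size_map.
have ds_ge2 : all (leq 2) ds.
  rewrite /ds /= map_rcons all_rcons /= -map_comp all_map.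
  apply/allP => x _; case: x => /=.
    by rewrite leq_subRL ?(leq_trans _ q_ge5).
  by rewrite leq_subRL ?(leq_trans _ q_ge5).
have [//|//|j lt_j|bs bsE bs_flags] := @bundle_suffix q row 0 ds.
  by rewrite add0n /deg_at deg_row.
have endsE : map single (ends q row) = true :: end_flags ds.
  by rewrite /ends /out_edges -szE bsE /= bs_flags.
have flagsE : end_flags ds =
    rcons (map negb (true :: subst (tau (q - 4)) w)) true.
  rewrite /ds [map _ (row_kinds w)]/= map_rcons end_flags_cons ?size_rcons //=; congr (_ :: _).
  elim: (w) => [|x u IH] //.
  rewrite [LHS]end_flags_cons ?size_rcons // IH /subst [flatten _]/= map_cat.
  rewrite rcons_cat /tau map_cat map_nseq -catA /=; congr (nseq _ _ ++ _).
  (* Apart from its two shared edges, type A keeps [q - 4] edges and type B keeps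
     [q - 3 = 1 + (q - 4)]. *)
  by case: x; rewrite /= -!subnS ?add0n // add1n subnSK // ltnW.
rewrite (kinds_next_row_flags (fs := map negb (true :: subst (tau (q - 4)) w))).
  by rewrite mapK //; exact: negbK.
by rewrite endsE flagsE.
Qed.

(** Rows are counted from row 2, as [2(n + 2) - 3 = 2n + 1]. The final 0 of the word is the right
    winger. *)
Lemma pascal_row_fibword (q n : nat) : 5 <= q ->
  exists2 g, fibword q n.*2.+1 = rcons g false
           & map vkind (pascal_row q n.+2) = row_kinds (true :: g).
Proof.
move=> q_ge5; elim: n => [|n [g fE rowE]].
  by exists [::] => //; exact: (@kinds_next_row q _ [::]).
exists (subst (tau (q - 4)) (true :: g)); last exact: kinds_next_row.
rewrite doubleS fibword_rho fE -!cats1 subst_cat {2}/subst /= cats0.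
have -> : subst (tau (q - 4)) (true :: g) =
  (nseq (q - 4) false ++ [:: true]) ++ subst (tau (q - 4)) g by [].
by rewrite tau_rho /rho -!catA.
Qed.

Theorem theorem2 (q n : nat) (hq : 5 <= q) (hn : 2 <= n) :
  [/\ word_equiv ([:: false; true] ++ fibword q (2 * n - 3)) (pascal_word q n),
      size (fibword q (2 * n - 3)) = bifib 1 (q - 4) (2 * n - 2)
    & size (pascal_word q n) = row_size q n].
Proof.
case: n hn => [|[|n]] // _.
have -> : 2 * n.+2 - 3 = n.*2.+1 by rewrite mul2n !doubleS !subSS subn0.
have -> : 2 * n.+2 - 2 = n.*2.+2 by rewrite mul2n !doubleS !subSS subn0.
split; last by rewrite size_map.
  have [g fE rowE] := pascal_row_fibword n hq.
  pose kind_letter c := if c is TypeA then A else B.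
  rewrite /word_equiv fE /pascal_word.
  rewrite (eq_map (g := kind_letter \o vkind)) // map_comp rowE /=.
  rewrite !map_rcons -map_comp; congr [:: _, _ & rcons _ _].
  by apply: eq_map => -[].
exact: size_fibword.
Qed.
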